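(* Fix an integer $n>2$. Let $c$ be a nonzero square-free integer with $c\ne\pm1$. For $d\in\mathbb{Z}$ let $g_d(x)=x^n+cx^{n-1}+cd$, and consider those $d$ for which $g_d$ is irreducible, with $\theta_d$ a root of $g_d$. Let \[B=\frac{6}{\pi^2}\prod_{p\mid c}\frac{p}{p+1}-\left(1-\frac{6}{\pi^2}\prod_{p\mid n}\frac{p^2}{p^2-1}\right),\] where the products run over primes. Then $B$ is a lower bound on the natural density of the set of integers $d$ such that $\mathbb{Z}[\theta_d]$ is the full ring of integers of $\mathbb{Q}(\theta_d)$. In particular, if $c$ has exactly one prime factor, or $c$ has exactly two prime factors and is coprime to $6$, then $B>0$ and there are infinitely many such $d$.
   Context: For a set $A$ of integers, its natural density is $\lim_{x\to\infty}\#\{a\in A: a\le x\}/x$ (taken over the relevant counting of integers); ''$B$ is a lower bound on the density'' means this proportion is asymptotically at least $B$. *)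

(* Defs.v *)
From HB Require Import structures.
From mathcomp Require Import all_boot all_order all_algebra all_field.
From mathcomp Require Import boolp reals trigo.
Set Implicit Arguments. Unset Strict Implicit. Unset Printing Implicit Defensive.
Import Order.TTheory GRing.Theory Num.Theory.
Local Open Scope ring_scope.

Definition squarefree (c : int) : Prop :=
  forall p : nat, prime p -> ~~ (p * p %| `|c|)%N.

Definition gpoly (n : nat) (c d : int) : {poly rat} :=
  'X^n + (c%:~R : rat) *: 'X^(n.-1) + ((c * d)%:~R : rat)%:P.

Definition in_Qadj (t x : algC) : Prop :=
  exists p : {poly rat}, x = (map_poly (fun q : rat => ratr q) p).[t].

Definition in_Zadj (t x : algC) : Prop :=
  exists p : {poly int}, x = (map_poly (fun z : int => z%:~R) p).[t].

Definition Zadj_is_ring_of_integers (t : algC) : Prop :=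
  forall x : algC, (in_Qadj t x /\ x \in Aint) <-> in_Zadj t x.

(* the set of d of the theorem: g_d irreducible and Z[theta_d] = O_{Q(theta_d)}
   for a root theta_d (all roots of an irreducible polynomial are conjugate,
   so we require it for every complex root). *)
Definition good_d (n : nat) (c d : int) : Prop :=
  irreducible_poly (gpoly n c d) /\
  forall t : algC, root (map_poly (fun q : rat => ratr q) (gpoly n c d)) t ->
    Zadj_is_ring_of_integers t.

Definition count_sym (S : int -> Prop) (N : nat) : nat :=
  #|[set k : 'I_(2 * N).+1 | `[< S (k%:Z - N%:Z) >] ]|.

(* "B is a lower bound on the natural density of S":
   liminf_{N -> oo} #{d in S : |d| <= N} / (2N+1) >= B *)
Definition density_lower_bound (R : realType) (S : int -> Prop) (B : R) : Prop :=
  forall eps : R, 0 < eps -> exists N0 : nat, forall N : nat, (N0 <= N)%N ->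
    B - eps <= (count_sym S N)%:R / ((2 * N).+1)%:R.

Definition Bconst (R : realType) (n : nat) (c : int) : R :=
  6 / (pi ^+ 2) * \prod_(p <- primes `|c|) (p%:R / (p%:R + 1))
  - (1 - 6 / (pi ^+ 2) * \prod_(p <- primes n) (p%:R ^+ 2 / (p%:R ^+ 2 - 1))).

(* Main.v *)
Require Import Defs.
From HB Require Import structures.
From mathcomp Require Import all_boot all_order all_algebra all_field.
From mathcomp Require Import boolp classical_sets reals topology normedtype.
From mathcomp Require Import derive trigo.
From mathcomp Require Import ring lra zify.
Set Implicit Arguments. Unset Strict Implicit. Unset Printing Implicit Defensive.
Import Order.TTheory GRing.Theory Num.Theory.
Import numFieldNormedType.Exports.
Local Open Scope ring_scope.

(** Write h(d) = n^n d + (-(n-1)c)^(n-1). By Dedekind's criterion, Z[theta_d] is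
    maximal at a prime p as soon as g_d has, modulo p, at most one multiple root
    r, and p^2 does not divide g_d(r). Here r = 0 if p | cd, and otherwise r is
    the critical point -(n-1)c/n, where n^n g_d(r) = c h(d). So d is good if it
    is squarefree and coprime to c, and p^2 does not divide h(d) for any prime p
    not dividing n; irreducibility is Eisenstein's criterion at a prime factor
    of c.

    Both conditions on d say that linear forms in d avoid the multiples of p or
    of p^2. By the Chinese remainder theorem the small primes contribute an
    exact product, and the primes p > y exclude a proportion at most 1/y + o(1)
    because the forms are linear. The products are bounded below by
    prod_p (1 - p^-2) >= 6/pi^2, which only needs the half
    sum 1/k^2 <= pi^2/6 of Euler's formula; it follows from sin x <= x and
    the exact evaluation of sum 1/sin^2 over the odd multiples of pi/2^(m+2).
    The two conditions are combined by |A inter B| >= |A| + |B| - total, and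
    B > 0 reduces to pi^2 < 10, a consequence of sin (pi/4)^2 = 1/2. *)

(** * The ring Z[t] *)

Definition evalZ (t : algC) : {poly int} -> algC :=
  horner_eval t \o map_poly intr.

HB.instance Definition _ (t : algC) :=
  GRing.RMorphism.copy (evalZ t) (horner_eval t \o map_poly intr).

Definition Zadj (t : algC) : {pred algC} := [pred x | `[< in_Zadj t x >]].

Section Zadj.
Variable t : algC.

Lemma evalZC (z : int) : evalZ t z%:P = z%:~R.
Proof. by rewrite /evalZ /= map_polyC horner_evalE hornerC. Qed.

Lemma evalZX : evalZ t 'X = t.
Proof. by rewrite /evalZ /= map_polyX horner_evalE hornerX. Qed.

Lemma evalZ_sum_coef f : evalZ t f = \sum_(i < size f) (f`_i)%:~R * t ^+ i.
Proof.
rewrite -{1}[f]coefK poly_def rmorph_sum; apply: eq_bigr => i _.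
by rewrite -mul_polyC rmorphM rmorphXn /= evalZC evalZX.
Qed.

Lemma ZadjP x : reflect (exists f, x = evalZ t f) (x \in Zadj t).
Proof. exact: asboolP. Qed.

Lemma evalZ_Zadj f : evalZ t f \in Zadj t.
Proof. by apply/ZadjP; exists f. Qed.

Lemma Zadj_subring_closed : subring_closed (Zadj t).
Proof.
split=> [|x y /ZadjP[f ->] /ZadjP[g ->]|x y /ZadjP[f ->] /ZadjP[g ->]].
- by apply/ZadjP; exists 1; rewrite rmorph1.
- by rewrite -rmorphB evalZ_Zadj.
- by rewrite -rmorphM evalZ_Zadj.
Qed.

HB.instance Definition _ :=
  GRing.isSubringClosed.Build algC (Zadj t) Zadj_subring_closed.

End Zadj.

Lemma Aint_monic_root (x : algC) : x \in Aint ->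
  exists2 m : {poly int}, m \is monic & evalZ x m = 0.
Proof.
move=> /floorpP[m mE]; exists m.
  have := minCpoly_monic x; rewrite mE !monicE lead_coef_map_inj //.
    by rewrite -[1]/(1%:~R) eqr_int.
  exact: intr_inj.
by rewrite /evalZ /= horner_evalE -mE; apply/rootP/root_minCpoly.
Qed.

Lemma monic_root_Aint (f : {poly int}) (x : algC) :
  f \is monic -> evalZ x f = 0 -> x \in Aint.
Proof.
move=> f_monic fx0; apply: (@root_monic_Aint (map_poly intr f)).
- exact/rootP.
- exact: monic_map.
- by apply/polyOverP => i; rewrite coef_map intr_int.
Qed.

Lemma ratr_map_intr (f : {poly int}) :
  map_poly ratr (map_poly (intr : int -> rat) f) =
  map_poly (intr : int -> algC) f.
Proof. by rewrite -map_poly_comp; apply: eq_map_poly => z; rewrite /= rmorph_int. Qed.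

(* This multiplies an integral equation of [a] of degree [k] by [y ^+ k]. *)
Lemma Aint_quotient_power (t a : algC) (y f : {poly int}) : a \in Aint ->
  evalZ t f = evalZ t y * a -> exists k w, evalZ t (f ^+ k + y * w) = 0.
Proof.
move=> /Aint_monic_root[m m_monic ma0] fya.
have size_m : size m = (size m).-1.+1.
  by rewrite prednK // size_poly_gt0 monic_neq0.
set k := (size m).-1 in size_m.
exists k, (\sum_(i < k) (m`_i)%:P * y ^+ (k.-1 - i) * f ^+ i).
have -> : 0 = evalZ t y ^+ k * evalZ a m by rewrite ma0 mulr0.
rewrite (evalZ_sum_coef a) size_m big_ord_recr /= -[m`_k]lead_coefE (monicP m_monic).
rewrite mul1r mulrDr -exprMn -fya addrC rmorphD rmorphXn rmorphM rmorph_sum /=.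
congr (_ + _); rewrite !mulr_sumr; apply: eq_bigr => i _.
have -> : evalZ t y ^+ k = evalZ t y * evalZ t y ^+ (k.-1 - i) * evalZ t y ^+ i.
  by rewrite -exprS -exprD; congr (_ ^+ _); have := ltn_ord i; lia.
by rewrite !rmorphM !rmorphXn /= evalZC fya exprMn; ring.
Qed.

Definition Zadj_maximal_at (t : algC) (p : nat) : Prop :=
  forall a, a \in Aint -> p%:R * a \in Zadj t -> a \in Zadj t.

Lemma in_Qadj_natmul (t x : algC) : in_Qadj t x ->
  exists2 k, (0 < k)%N & k%:R * x \in Zadj t.
Proof.
move=> [f ->]; have [q [k k0 ->]] := rat_poly_scale f.
exists `|k|%N; first by rewrite absz_gt0.
apply/ZadjP; exists ((Num.sg k)%:P * q).
rewrite rmorphM /= evalZC /evalZ /= horner_evalE map_polyZ hornerZ ratr_map_intr.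
rewrite fmorphV rmorph_int mulrA; congr (_ * _).
by apply: (@mulIf _ k%:~R); rewrite ?mulfVK ?intr_eq0 // -intrM -normrEsg -abszE pmulrn.
Qed.

Lemma Zadj_maximal_ring_of_integers (t : algC) : t \in Aint ->
  (forall p, prime p -> Zadj_maximal_at t p) -> Zadj_is_ring_of_integers t.
Proof.
move=> tA t_max x; split=> [[/in_Qadj_natmul[k k0 kx] xA]|[f ->]]; last first.
  split; first by exists (map_poly intr f); rewrite ratr_map_intr.
  rewrite horner_coef rpred_sum // => i _.
  by rewrite coef_map rpredM ?rpredX // Aint_int.
suff: x \in Zadj t by move/asboolP.
elim/ltn_ind: k k0 x xA kx => k IHk k0 x xA kx.
have [k1|k1] := leqP k 1.
  by have k_eq1 : k = 1%N by [lia]; rewrite k_eq1 mul1r in kx.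
have kE := divnK (pdiv_dvd k).
apply: (t_max (pdiv k)) => //; first exact: pdiv_prime.
apply: (IHk (k %/ pdiv k)%N).
- by rewrite ltn_Pdiv // prime_gt1 // pdiv_prime.
- by rewrite divn_gt0 ?prime_gt0 ?pdiv_prime // dvdn_leq // pdiv_dvd.
- by rewrite rpredM // Aint_Cnat.
- by rewrite mulrA -natrM kE.
Qed.

(** * Dedekind's criterion *)

Lemma separable_dvdp_exp (F : fieldType) (q f : {poly F}) k :
  separable_poly q -> q %| f ^+ k -> q %| f.
Proof.
move=> q_sep qfk; have /dvdpP[u qE] := dvdp_gcdl q f.
have uq : u %| q by rewrite qE dvdp_mulr.
have u_cop_gcd : coprimep u (gcdp q f).
  by have := q_sep; rewrite {1}qE separable_mul => /and3P[].
have u_cop_f : coprimep u f.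
  rewrite coprimep_def; apply/eqP; have : coprimep (gcdp u f) (gcdp u f).
    apply: coprimep_dvdr (dvdp_gcdl u f) (coprimep_dvdl _ u_cop_gcd).
    by rewrite dvdp_gcd dvdp_gcdr (dvdp_trans (dvdp_gcdl _ _)).
  by rewrite coprimepp => /eqP.
have : u %| f ^+ k := dvdp_trans uq qfk.
rewrite -[f ^+ k]mulr1 Gauss_dvdpr ?coprimep_expr // dvdp1.
move=> /size_poly1P[z z0 uz].
by rewrite qE uz mul_polyC dvdpZl // dvdp_gcdr.
Qed.

Local Notation redp p := (map_poly (intr : int -> 'F_p)).

Section ReductionModP.
Variables (p : nat) (p_pr : prime p).

Lemma intr_Fp_eq0 (z : int) : (z%:~R == 0 :> 'F_p) = (p %| z)%Z.
Proof. by rewrite (dvdz_pcharf (pchar_Fp p_pr)). Qed.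

Lemma natr_Fp_eq0 n : (n%:R == 0 :> 'F_p) = (p %| n)%N.
Proof. by rewrite pmulrn intr_Fp_eq0. Qed.

Lemma redp_nat : redp p p%:R = 0.
Proof. by rewrite rmorph_nat -polyC_natr pchar_Fp_0 ?polyC0. Qed.

Lemma redp_lift (q : {poly 'F_p}) : exists s : {poly int}, redp p s = q.
Proof.
exists (map_poly (fun x : 'F_p => Posz x) q).
apply/polyP => i; rewrite coef_map /= coef_map_id0 //=.
by rewrite -pmulrn natr_Zp.
Qed.

Lemma redp_eq0 (f : {poly int}) : redp p f = 0 -> exists u, f = p%:R * u.
Proof.
move=> f0; exists (map_poly (fun z => (z %/ p)%Z) f); apply/polyP => i.
rewrite mulr_natl coefMn coef_map_id0 ?div0z // -mulr_natr natz divzK //.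
by rewrite -intr_Fp_eq0 -[_%:~R]/(intr _) -coef_map f0 coef0.
Qed.

Lemma redp_dvdp (f h : {poly int}) : redp p h %| redp p f ->
  exists s u, f = h * s + p%:R * u.
Proof.
move=> /dvdpP[s' fE]; have [s sE] := redp_lift s'.
have [u uE] : exists u, f - h * s = p%:R * u.
  by apply: redp_eq0; rewrite rmorphB rmorphM /= sE fE mulrC subrr.
by exists s, u; rewrite -uE addrC subrK.
Qed.

End ReductionModP.

Section Dedekind.
Variables (g : {poly int}) (t : algC) (p : nat).
Hypothesis g_monic : g \is monic.
Hypothesis g_irr : irreducible_poly (map_poly (intr : int -> rat) g).
Hypothesis g_root : evalZ t g = 0.
Hypothesis p_pr : prime p.

Lemma evalZ_eq0_dvd u : evalZ t u = 0 -> exists v, u = g * v.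
Proof.
move=> ut0; have := Pdiv.RingMonic.rdivp_eq g_monic u.
set v := Pdiv.Ring.rdivp u g; set r := Pdiv.Ring.rmodp u g => uE; exists v.
have rt0 : evalZ t r = 0.
  by move: ut0; rewrite uE rmorphD rmorphM /= g_root mulr0 add0r.
have [m [mE m_monic] mP] := minCpolyP t.
have mg : m %| map_poly intr g by rewrite -mP ratr_map_intr; apply/rootP.
have mr : m %| map_poly intr r by rewrite -mP ratr_map_intr; apply/rootP.
have size_m : size m != 1.
  apply: contraTneq (root_minCpoly t) => /eqP/size_poly1P[z z0 mz].
  by rewrite mE mz map_polyC /= rootC fmorph_eq0.
have /eqp_dvdl m_eq_g := g_irr.2 _ size_m mg.
suff /eqP r0 : r == 0 by rewrite uE r0 addr0 mulrC.
apply/negP => /negP r0; move: mr; rewrite m_eq_g => /dvdp_leq.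
rewrite map_poly_eq0_id0 ?intr_eq0 ?lead_coef_eq0 // => /(_ r0).
rewrite !size_map_inj_poly ?rmorph0 //; try exact: intr_inj.
by rewrite leqNgt Pdiv.Ring.ltn_rmodp monic_neq0.
Qed.

(* A power of [f] is a multiple of [y] modulo [g]. *)
Lemma redp_dvdp_Aint_quotient (h y f : {poly int}) (a : algC) :
  separable_poly (redp p h) -> redp p h %| redp p g -> redp p h %| redp p y ->
  a \in Aint -> evalZ t f = evalZ t y * a -> redp p h %| redp p f.
Proof.
move=> h_sep hg hy aA fya.
have [k [w /evalZ_eq0_dvd[z fkE]]] := Aint_quotient_power aA fya.
apply: (separable_dvdp_exp (k := k)) => //; rewrite -rmorphXn.
have -> : f ^+ k = g * z - y * w by rewrite -fkE addrK.
by rewrite rmorphB !rmorphM /= dvdp_sub ?dvdp_mulr.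
Qed.

Lemma Zadj_coprimep_mul (f w : {poly int}) (a : algC) :
  coprimep (redp p f) (redp p w) -> p%:R * a \in Zadj t ->
  evalZ t f * a \in Zadj t -> evalZ t w * a \in Zadj t -> a \in Zadj t.
Proof.
move=> /Bezout_eq1_coprimepP[[u' v'] /=].
have [u <-] := redp_lift u'; have [v <-] := redp_lift v' => uvE pa fa wa.
have [z zE] : exists z, 1 - (u * f + v * w) = p%:R * z.
  by apply: redp_eq0 => //; rewrite rmorphB rmorph1 rmorphD !rmorphM /= uvE subrr.
have -> : a = evalZ t u * (evalZ t f * a) + evalZ t v * (evalZ t w * a)
              + evalZ t z * (p%:R * a).
  rewrite !mulrA -2!mulrDl -[LHS]mul1r; congr (_ * _).
  have -> : evalZ t z * p%:R = evalZ t (p%:R * z) by rewrite rmorphM rmorph_nat mulrC.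
  by rewrite -zE rmorphB rmorph1 rmorphD !rmorphM /= addrC subrK.
by rewrite !rpredD // rpredM // evalZ_Zadj.
Qed.

Section Criterion.
Variables h f w : {poly int}.
Hypothesis gE : g = h * f + p%:R * w.
Hypothesis h_sep : separable_poly (redp p h).
Hypothesis fw_coprime : coprimep (redp p f) (redp p w).

Lemma redp_dvdp_factor : redp p h %| redp p g.
Proof. by rewrite gE rmorphD !rmorphM /= redp_nat // mul0r addr0 dvdp_mulr. Qed.

(* With [p a = (h s + p u)(t)] and [h(t) a = (h v + p z)(t)], the relation
   [h(t) f(t) = - p w(t)] puts [f(t) a] and [w(t) a] in [Z[t]]. *)
Lemma dedekind_descent (a : algC) : a \in Aint -> p%:R * a \in Zadj t ->
  evalZ t h * a \in Zadj t -> a \in Zadj t.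
Proof.
move=> aA pa ha; have p0 : p%:R != 0 :> algC by rewrite pnatr_eq0 -lt0n prime_gt0.
have hf : evalZ t h * evalZ t f = - (p%:R * evalZ t w).
  have := g_root; rewrite gE rmorphD !rmorphM rmorph_nat /= => /eqP.
  by rewrite addr_eq0 => /eqP.
have hg := redp_dvdp_factor.
apply: (Zadj_coprimep_mul fw_coprime pa); apply/ZadjP.
  have /ZadjP[P paE] := pa.
  have [s [u PE]] : exists s u, P = h * s + p%:R * u.
    apply: redp_dvdp => //; apply: (redp_dvdp_Aint_quotient (y := p%:R) h_sep) aA _ => //.
      by rewrite redp_nat // dvdp0.
    by rewrite rmorph_nat -paE.
  exists (f * u - w * s); apply: (mulfI p0).
  rewrite mulrCA paE PE !(rmorphB, rmorphD, rmorphM, rmorph_nat) /=.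
  by rewrite mulrDr mulrA [evalZ t f * evalZ t h]mulrC hf; ring.
have /ZadjP[V haE] := ha.
have [v [z VE]] : exists v z, V = h * v + p%:R * z.
  by apply: redp_dvdp => //; apply: (redp_dvdp_Aint_quotient h_sep) aA (esym haE).
exists (w * v - f * z); apply: (mulfI p0).
have : - (evalZ t f * (evalZ t h * a)) = - (evalZ t f * evalZ t V) by rewrite haE.
rewrite VE !(rmorphB, rmorphD, rmorphM, rmorph_nat) /= mulrDr !mulrA.
rewrite [evalZ t f * evalZ t h]mulrC hf !mulNr opprK => ->.
by ring.
Qed.

Theorem dedekind_criterion e : redp p g %| redp p h ^+ e -> Zadj_maximal_at t p.
Proof.
rewrite -rmorphXn => /(redp_dvdp p_pr)[s [u heE]] a aA pa.
have hA : evalZ t h \in Aint.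
  rewrite evalZ_sum_coef rpred_sum // => i _.
  by rewrite rpredM ?rpredX ?Aint_int // (monic_root_Aint g_monic).
have : evalZ t h ^+ e * a \in Zadj t.
  rewrite -rmorphXn heE rmorphD !rmorphM rmorph_nat /= g_root mul0r add0r.
  by rewrite mulrAC mulrC rpredM // evalZ_Zadj.
elim: e {heE} => [|e IHe]; first by rewrite expr0 mul1r.
rewrite exprS -mulrA => hea; apply/IHe/dedekind_descent => //.
  by rewrite rpredM // rpredX.
by rewrite mulrCA rpredM // rpredX // evalZ_Zadj.
Qed.

End Criterion.

Lemma Zadj_maximal_at_separable : separable_poly (redp p g) -> Zadj_maximal_at t p.
Proof.
move=> g_sep; apply: (@dedekind_criterion g 1 0 _ g_sep _ 1); rewrite ?expr1 //.
  by rewrite mulr1 mulr0 addr0.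
by rewrite rmorph1 coprime1p.
Qed.

End Dedekind.

Definition separable_away_from (F : fieldType) (r : F) (g : {poly F}) : Prop :=
  exists e q, g = ('X - r%:P) ^+ e.+1 * q /\ separable_poly (('X - r%:P) * q).

Lemma Zadj_maximal_at_separable_away (g : {poly int}) (t : algC) (p : nat) (r : int) :
  g \is monic -> irreducible_poly (map_poly (intr : int -> rat) g) ->
  evalZ t g = 0 -> prime p -> separable_away_from r%:~R (redp p g) ->
  ~~ ((p ^ 2)%N %| g.[r])%Z -> Zadj_maximal_at t p.
Proof.
move=> g_monic g_irr g_root p_pr [e [q' []]]; have [q <-] := redp_lift q'.
move=> gE h_sep p2g.
have redXr : redp p ('X - r%:P) = 'X - (r%:~R)%:P.
  by rewrite rmorphB /= map_polyX map_polyC.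
pose h := ('X - r%:P) * q; pose f := ('X - r%:P) ^+ e.
have [w wE] : exists w, g - h * f = p%:R * w.
  by apply: redp_eq0; rewrite // rmorphB !rmorphM rmorphXn /= redXr gE exprS; ring.
apply: (@dedekind_criterion g t p g_monic g_irr g_root p_pr h f w _ _ _ e.+1).
- by rewrite -wE addrC subrK.
- by rewrite /h rmorphM /= redXr.
- rewrite rmorphXn /= redXr coprimep_expl // coprimep_sym coprimep_XsubC.
  rewrite rootE horner_map /= intr_Fp_eq0 //; apply: contra p2g => /dvdzP[z wrE].
  have -> : g.[r] = (p ^ 2)%N%:Z * z.
    rewrite -(subrK (h * f) g) wE hornerD !hornerM hornerXsubC subrr !mul0r addr0.
    by rewrite wrE -polyC_natr hornerC natz -mulnn PoszM; ring.
  exact: dvdz_mulr.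
- by rewrite gE rmorphM /= redXr exprMn dvdp_mul // exprS dvdp_mulr.
Qed.

(** * Trinomials *)

Definition trinomial (S : nzRingType) (n : nat) (a b : S) : {poly S} :=
  'X^n + a *: 'X^(n.-1) + b%:P.

(* The discriminant of the trinomial is [b ^+ n.-2 * trinomial_disc n a b], up
   to sign. *)
Definition trinomial_disc (S : nzRingType) (n : nat) (a b : S) : S :=
  n%:R ^+ n * b + a * (- (n.-1%:R * a)) ^+ n.-1.

Lemma map_trinomial (S S' : nzRingType) (f : {rmorphism S -> S'}) n a b :
  map_poly f (trinomial n a b) = trinomial n (f a) (f b).
Proof. by rewrite /trinomial !rmorphD /= map_polyZ !map_polyXn map_polyC. Qed.

Lemma rmorph_trinomial_disc (S S' : nzRingType) (f : {rmorphism S -> S'}) n a b :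
  f (trinomial_disc n a b) = trinomial_disc n (f a) (f b).
Proof.
by rewrite /trinomial_disc rmorphD !rmorphM !rmorphXn rmorphN rmorphM !rmorph_nat.
Qed.

Lemma horner0_trinomial (S : nzRingType) n (a b : S) :
  (1 < n)%N -> (trinomial n a b).[0] = b.
Proof.
by case: n => [|[|n]] // _; rewrite horner_coef0 !coefE /= mulr0 !add0r.
Qed.

Lemma size_trinomial (S : nzRingType) n (a b : S) :
  (0 < n)%N -> size (trinomial n a b) = n.+1.
Proof.
case: n => // n _; rewrite /trinomial -addrA size_polyDl size_polyXn //.
rewrite (leq_ltn_trans (size_polyD _ _)) // gtn_max size_polyC.
rewrite (leq_ltn_trans (size_scale_leq _ _)) ?size_polyXn //.
by case: eqP.
Qed.

Lemma trinomial_monic (S : nzRingType) n (a b : S) :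
  (0 < n)%N -> trinomial n a b \is monic.
Proof.
move=> n0; rewrite monicE lead_coefE size_trinomial // /trinomial !coefE eqxx /=.
by case: n n0 => // n _; rewrite eqn_leq ltnn mulr0 !addr0.
Qed.

Lemma deriv_trinomial (S : comNzRingType) n (a b : S) : (1 < n)%N ->
  (trinomial n a b)^`() = 'X^(n.-2) * (n%:R *: 'X + (n.-1%:R * a)%:P).
Proof.
case: n => [|[|n]] // _; rewrite /trinomial !derivD derivZ !derivXn derivC addr0 /=.
rewrite mulrDr -scalerAr -exprSr scaler_nat [_ * _%:P]mulrC mul_polyC.
by rewrite -scalerA scaler_nat -scalerMnr.
Qed.

Lemma trinomial_critical_value (S : comNzRingType) n (a b r : S) : (0 < n)%N ->
  n%:R * r = - (n.-1%:R * a) ->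
  n%:R ^+ n * (trinomial n a b).[r] = trinomial_disc n a b.
Proof.
case: n => // n _ /= nr; rewrite /trinomial_disc /= -nr.
have aE : a = n.+1%:R * r + n.+1%:R * a by rewrite nr -natr1; ring.
by rewrite {2}aE /trinomial !hornerE /= exprMn !exprS; ring.
Qed.

Lemma trinomial_irreducible n (a b : int) p : (1 < n)%N -> prime p ->
  (p %| a)%Z -> (p %| b)%Z -> ~~ ((p ^ 2)%N %| b)%Z ->
  irreducible_poly (map_poly (intr : int -> rat) (trinomial n a b)).
Proof.
move=> n1 p_pr pa pb p2b; have n0 := ltnW n1.
apply/irreducible_rat_int/(@eisenstein_crit p) => //.
- by rewrite size_trinomial // eqSS gtn_eqF.
- by rewrite (monicP (trinomial_monic _ _ n0)) dvdz1 /= gtn_eqF // prime_gt1.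
- by rewrite -horner_coef0 horner0_trinomial.
rewrite size_trinomial //= => i i_lt_n.
rewrite /trinomial !coefE (ltn_eqF i_lt_n) add0r rpredD ?dvdz_mulr //.
by case: ifP => _; rewrite ?rpred0.
Qed.

Section TrinomialField.
Variables (F : fieldType) (n : nat) (a : F).
Hypothesis n1 : (1 < n)%N.

Lemma trinomial0_separable_away : separable_away_from 0 (trinomial n a 0).
Proof.
have -> : trinomial n a 0 = 'X^(n.-1) * ('X + a%:P).
  case: n n1 => // m _; rewrite /trinomial addr0 mulrDr -exprSr.
  by rewrite [_ * _%:P]mulrC mul_polyC.
rewrite /separable_away_from subr0; have [->|a0] := eqVneq a 0.
  exists n.-1, 1; split; last by rewrite mulr1 unlock derivX coprimep1.
  by rewrite addr0 mulr1 -exprSr.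
exists n.-2, ('X + a%:P); split; first by case: n n1 => [|[]].
rewrite mulrC -{2}['X]subr0 separable_root rootE !hornerE a0 andbT.
by rewrite unlock derivD derivX derivC addr0 coprimep1.
Qed.

Variable b : F.
Hypothesis b0 : b != 0.

Lemma trinomial_separable_pchar :
  n%:R = 0 :> F -> a != 0 -> separable_poly (trinomial n a b).
Proof.
move=> n0 a0; rewrite unlock deriv_trinomial // n0 scale0r add0r coprimepMr.
rewrite coprimep_expr /=; last first.
  by rewrite -['X]subr0 coprimep_XsubC rootE horner0_trinomial.
have nE : n.-1%:R = -1 :> F.
  by apply/eqP; rewrite -subr_eq0 opprK natr1 prednK ?n0 // ltnW.
rewrite nE mulN1r; apply: coprimep_dvdl (coprimep1 _).
by rewrite dvdp1 size_polyC oppr_eq0 a0.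
Qed.

Section CriticalPoint.
Variable r : F.
Hypothesis n0 : n%:R != 0 :> F.
Hypothesis nr : n%:R * r = - (n.-1%:R * a).

Lemma deriv_trinomial_critical :
  (trinomial n a b)^`() = n%:R *: ('X^(n.-2) * ('X - r%:P)).
Proof.
rewrite deriv_trinomial //; have -> : n.-1%:R * a = - (n%:R * r) by rewrite nr opprK.
by rewrite polyCN polyCM mul_polyC -scalerBr -scalerAr.
Qed.

Lemma trinomial_separable_critical :
  ~~ root (trinomial n a b) r -> separable_poly (trinomial n a b).
Proof.
move=> gr; rewrite unlock deriv_trinomial_critical coprimepZr // coprimepMr.
rewrite coprimep_XsubC gr andbT coprimep_expr //.
by rewrite -['X]subr0 coprimep_XsubC rootE horner0_trinomial.
Qed.

(* Writing [g = (X - r) ^ 2 * q] and [h = (X - r) * q], the derivative of [g]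
   gives [n X ^ (n - 2) = q + h'], so [h'] is prime to [q] and to [X - r]. *)
Lemma trinomial_separable_away :
  root (trinomial n a b) r -> separable_away_from r (trinomial n a b).
Proof.
set g := trinomial n a b => gr; have g' := deriv_trinomial_critical.
have r0 : r != 0 by apply: contraTneq gr => ->; rewrite rootE horner0_trinomial.
have /factor_theorem[h gE] := gr.
have hr : root h r.
  have := congr1 (fun f => f.[r]) g'; rewrite -/g gE derivM derivXsubC mulr1.
  by rewrite hornerD hornerZ !hornerM hornerXsubC subrr !mulr0 add0r => /rootP.
have /factor_theorem[q hE] := hr.
have nX : n%:R *: 'X^(n.-2) = q + h^`().
  apply: (@mulIf _ ('X - r%:P)); first by rewrite polyXsubC_eq0.
  by rewrite -scalerAl -g' -/g gE derivM derivXsubC mulr1 mulrDl -hE addrC.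
have q0 : ~~ root q 0.
  apply: contra b0 => /rootP q00.
  by rewrite -(horner0_trinomial a b n1) -/g gE hE !hornerM q00 !mul0r.
have h'r : h^`().[r] = q.[r] by rewrite hE derivM derivXsubC !hornerE subrr mulr0 add0r.
exists 1, q; split; first by rewrite gE hE -mulrA mulrC.
rewrite mulrC -hE unlock {1}hE coprimepMl; apply/andP; split.
  have -> : h^`() = n%:R *: 'X^(n.-2) - q by rewrite nX addrAC subrr add0r.
  rewrite addrC -mulN1r coprimep_addl_mul coprimepZr // coprimep_expr //.
  by rewrite -['X]subr0 coprimep_XsubC.
rewrite coprimep_sym coprimep_XsubC rootE h'r; apply: contraTneq isT => qr.
have := congr1 (fun f => f.[r]) nX; rewrite !hornerE h'r qr addr0 => /eqP.
by rewrite mulf_eq0 expf_eq0 (negPf n0) (negPf r0) andbF.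
Qed.

End CriticalPoint.
End TrinomialField.

Lemma intr_Zp_eq0 (q : nat) (z : int) : (1 < q)%N ->
  (z%:~R == 0 :> 'Z_q) = (q %| z)%Z.
Proof.
move=> q1; have natr_eq0 n : (n%:R == 0 :> 'Z_q) = (q %| n)%N.
  by rewrite -val_eqE /= val_Zp_nat.
by case: z => n; rewrite ?NegzE ?mulrNz ?oppr_eq0 ?dvdzN -pmulrn natr_eq0.
Qed.

(* The critical point [- (n - 1) a / n] makes sense modulo [q]. *)
Lemma trinomial_critical_mod (q n : nat) (a b : int) :
  (1 < q)%N -> (0 < n)%N -> coprime q n ->
  exists r : int, (q %| n%:R * r + n.-1%:R * a)%Z /\
    (q %| n%:R ^+ n * (trinomial n a b).[r] - trinomial_disc n a b)%Z.
Proof.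
move=> q1 n0 qn; have n_unit : (n%:R : 'Z_q) \is a GRing.unit by rewrite unitZpE.
pose x : 'Z_q := - (n.-1%:R * a%:~R) / n%:R; exists (x : nat)%:Z.
have xE : (x : nat)%:Z%:~R = x by rewrite -pmulrn natr_Zp.
have nx : n%:R * x = - (n.-1%:R * a%:~R) by rewrite mulrC divrK.
rewrite -!intr_Zp_eq0 // rmorphD rmorphB !rmorphM rmorphXn !rmorph_nat /= xE nx.
rewrite addNr eqxx; split=> //.
rewrite rmorph_trinomial_disc -(trinomial_critical_value _ n0 nx) -map_trinomial.
by rewrite -xE horner_map subrr.
Qed.

Lemma trinomial_maximal_at (n : nat) (a b : int) (t : algC) (p : nat) :
  (1 < n)%N -> evalZ t (trinomial n a b) = 0 ->
  irreducible_poly (map_poly (intr : int -> rat) (trinomial n a b)) ->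
  prime p -> ~~ ((p ^ 2)%N %| b)%Z ->
  ((p %| n)%N -> (p %| a)%Z -> (p %| b)%Z) ->
  (~~ (p %| n)%N -> ~~ (p %| b)%Z -> ~~ ((p ^ 2)%N %| trinomial_disc n a b)%Z) ->
  Zadj_maximal_at t p.
Proof.
move=> n1 g_root g_irr p_pr p2b pn_pa p2disc; have n0 := ltnW n1.
have g_monic := trinomial_monic a b n0.
have [pb|pb] := boolP (p %| b)%Z.
  apply: (Zadj_maximal_at_separable_away (r := 0) g_monic g_irr g_root p_pr).
    rewrite map_trinomial /=; have /eqP -> : b%:~R == 0 :> 'F_p by rewrite intr_Fp_eq0.
    exact: trinomial0_separable_away.
  by rewrite horner0_trinomial.
have b0 : b%:~R != 0 :> 'F_p by rewrite intr_Fp_eq0.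
have [pn|pn] := boolP (p %| n)%N.
  apply: (Zadj_maximal_at_separable g_monic g_irr g_root p_pr); rewrite map_trinomial.
  apply: trinomial_separable_pchar => //; first by apply/eqP; rewrite natr_Fp_eq0.
  by rewrite intr_Fp_eq0 //; apply: contra pb => /(pn_pa pn).
have p2_gt1 : (1 < p ^ 2)%N by rewrite -{1}(exp1n 2) ltn_exp2r // prime_gt1.
have p2n : coprime (p ^ 2) n by rewrite coprime_pexpl // prime_coprime.
have [r [p2r p2gr]] := trinomial_critical_mod a b p2_gt1 n0 p2n.
have p_p2 : (p %| (p ^ 2)%N%:Z)%Z by rewrite dvdzE dvdn_exp.
have nF : n%:R != 0 :> 'F_p by rewrite natr_Fp_eq0.
have nrF : n%:R * r%:~R = - (n.-1%:R * a%:~R) :> 'F_p.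
  apply/eqP; have := dvdz_trans p_p2 p2r.
  by rewrite -intr_Fp_eq0 // rmorphD !rmorphM !rmorph_nat addr_eq0.
have [gr|gr] := boolP (root (redp p (trinomial n a b)) r%:~R); last first.
  apply: (Zadj_maximal_at_separable g_monic g_irr g_root p_pr); rewrite map_trinomial.
  by apply: (trinomial_separable_critical n1 b0 nF nrF); rewrite -map_trinomial.
apply: (Zadj_maximal_at_separable_away (r := r) g_monic g_irr g_root p_pr).
  rewrite map_trinomial; apply: (trinomial_separable_away n1 b0 nF nrF).
  by rewrite -map_trinomial.
apply: contra (p2disc pn pb) => p2g; move: p2gr.
by rewrite rpredBl // dvdz_mull.
Qed.

(* [trinomial_disc n c (c * d) = c * reduced_disc n c d]. *)
Definition reduced_disc (n : nat) (c d : int) : int :=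
  n%:R ^+ n * d + (- (n.-1%:R * c)) ^+ n.-1.

Lemma dvdz_sqr_mul_coprime (p : nat) (a b : int) : prime p -> ~~ (p %| a)%Z ->
  ((p ^ 2)%N %| a * b)%Z = ((p ^ 2)%N %| b)%Z.
Proof.
by move=> p_pr pa; rewrite Gauss_dvdzr // coprimezE /= coprime_pexpl // prime_coprime.
Qed.

Lemma squarefreeP (c : int) :
  squarefree c <-> (forall p, prime p -> ~~ ((p ^ 2)%N %| c)%Z).
Proof. by split=> c_sqf p /c_sqf; rewrite dvdzE /= mulnn. Qed.

Lemma squarefreeM (c d : int) :
  squarefree c -> squarefree d -> coprimez c d -> squarefree (c * d).
Proof.
move=> /squarefreeP c_sqf /squarefreeP d_sqf cd; apply/squarefreeP => p p_pr.
have [pc|pc] := boolP (p %| c)%Z; last by rewrite dvdz_sqr_mul_coprime ?d_sqf.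
rewrite mulrC dvdz_sqr_mul_coprime ?c_sqf //; apply: contraTN cd => pd.
rewrite coprimezE; apply/negP => /(coprime_dvdl pc)/(coprime_dvdr pd).
by rewrite /coprime gcdnn gtn_eqF ?prime_gt1.
Qed.

Lemma good_d_criterion (n : nat) (c d : int) : (1 < n)%N ->
  c != 0 -> c != 1 -> c != -1 ->
  squarefree c -> squarefree d -> coprimez c d ->
  (forall p, prime p -> ~~ (p %| n)%N -> ~~ ((p ^ 2)%N %| reduced_disc n c d)%Z) ->
  good_d n c d.
Proof.
move=> n1 c0 c1 cN1 c_sqf d_sqf cd p2disc.
have /squarefreeP p2cd := squarefreeM c_sqf d_sqf cd.
have gE : gpoly n c d = map_poly intr (trinomial n c (c * d)) by rewrite map_trinomial.
have g_irr : irreducible_poly (gpoly n c d).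
  have c_gt1 : (1 < `|c|)%N by lia.
  have pc : (pdiv `|c| %| c)%Z by rewrite dvdzE pdiv_dvd.
  have p_pr := pdiv_prime c_gt1.
  by rewrite gE; apply: (trinomial_irreducible n1 p_pr pc); rewrite ?p2cd ?dvdz_mulr.
split=> // t; rewrite gE ratr_map_intr => /rootP g_root.
apply: Zadj_maximal_ring_of_integers => [|p p_pr].
  exact: monic_root_Aint (trinomial_monic c (c * d) (ltnW n1)) g_root.
apply: (trinomial_maximal_at n1 g_root) => //; rewrite -?gE ?p2cd //.
  by move=> _ pc; rewrite dvdz_mulr.
move=> pn pcd; have pc : ~~ (p %| c)%Z by apply: contra pcd; exact: dvdz_mulr.
have -> : trinomial_disc n c (c * d) = c * reduced_disc n c d.
  by rewrite /trinomial_disc /reduced_disc mulrDr mulrCA.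
by rewrite dvdz_sqr_mul_coprime // p2disc.
Qed.

(** * The Euler product of the inverse squares *)

Section TrigonometricBounds.
Variable R : realType.
Implicit Types x y : R.

Lemma le_of_derive_ge0 (f df : R -> R) a :
  (forall x, is_derive x 1 f (df x)) -> (forall x, a <= x -> 0 <= df x) ->
  forall x, a <= x -> f a <= f x.
Proof.
move=> fdf df_ge0 x ax; rewrite -subr_ge0.
have f_cont : {within `[a, x], continuous f}%classic.
  by apply: derivable_within_continuous => z _; have [] := fdf z.
have [y] := MVT_segment ax (fun z _ => fdf z) f_cont.
by rewrite in_itv /= => /andP[ay _] ->; rewrite mulr_ge0 ?df_ge0 ?subr_ge0.
Qed.

Lemma sin_le_id x : 0 <= x -> sin x <= x.
Proof.
move=> x0; have := @le_of_derive_ge0 (fun x => x - sin x) (fun x => 1 - cos x) 0.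
rewrite sin0 subr0 -subr_ge0; apply=> // z _.
by rewrite subr_ge0 cos_le1.
Qed.

Lemma cos_ge_quadratic x : 0 <= x -> 1 - x ^+ 2 / 2 <= cos x.
Proof.
move=> x0; suff : 1 <= cos x + x ^+ 2 / 2 by lra.
have := @le_of_derive_ge0 (fun x => cos x + x ^+ 2 / 2) (fun x => x - sin x) 0.
rewrite cos0 expr0n mul0r addr0; apply=> // z; last by rewrite subr_ge0; exact: sin_le_id.
by apply: trigger_derive; rewrite /GRing.scale /=; lra.
Qed.

Lemma sin_ge_cubic x : 0 <= x -> x - x ^+ 3 / 6 <= sin x.
Proof.
move=> x0; suff : 0 <= sin x - x + x ^+ 3 / 6 by lra.
have := @le_of_derive_ge0 (fun x => sin x - x + x ^+ 3 / 6)
  (fun x => cos x - 1 + x ^+ 2 / 2) 0.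
rewrite sin0 expr0n mul0r subr0 addr0; apply=> // z.
  by apply: trigger_derive; rewrite /GRing.scale /=; lra.
by move=> /cos_ge_quadratic; lra.
Qed.

Lemma sin_pi4_sqr : sin (pi / 4) ^+ 2 = 2^-1 :> R.
Proof.
have pi4E : pi / 2 = (pi / 4) *+ 2 :> R by field.
have := @cos_pihalf R; have := cos2Dsin2 (pi / 4 : R).
by rewrite pi4E cos_mulr2n; lra.
Qed.

Lemma pi_sqr_lt10 : pi ^+ 2 < 10 :> R.
Proof.
rewrite ltNge; apply/negP => pi10.
have pi_pos := @pi_gt0 R; have pi_lt4 : pi < 4 :> R by have := @pihalf_lt2 R; lra.
set y := pi / 4 : R; set u := y ^+ 2; have y0 : 0 <= y by rewrite /y; lra.
have u_ge : 5 / 8 <= u by rewrite /u /y exprMn; lra.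
have u_le : u <= 1 by rewrite /u exprn_ile1 // /y; lra.
have : (y * (1 - u / 6)) ^+ 2 <= sin y ^+ 2.
  have := sin_ge_cubic y0; have -> : y - y ^+ 3 / 6 = y * (1 - u / 6) by rewrite /u; ring.
  have : 0 <= y * (1 - u / 6) by rewrite mulr_ge0 //; lra.
  by move=> lower_ge0 sin_ge; rewrite ler_pXn2r // nnegrE (le_trans lower_ge0).
by rewrite sin_pi4_sqr exprMn -/u; nra.
Qed.

Lemma csc_sqr_double y : sin y != 0 -> cos y != 0 ->
  sin y ^- 2 + cos y ^- 2 = 4 * sin (y *+ 2) ^- 2.
Proof.
rewrite sin_mulr2n; have := cos2Dsin2 y.
move: (sin y) (cos y) => s c cs s0 c0.
have -> : s ^- 2 + c ^- 2 = (c ^+ 2 + s ^+ 2) / (s * c) ^+ 2 by field; rewrite s0 c0.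
by rewrite cs; field; rewrite s0 c0.
Qed.

Definition dyadic_angle (n k : nat) : R := (2 * k + 1)%:R * pi / 2 ^+ n.+2.

Lemma dyadic_angle_itv n k : (k < 2 ^ n)%N -> 0 < dyadic_angle n k < pi / 2.
Proof.
move=> k_lt; have pi_pos := @pi_gt0 R; apply/andP; split.
  by rewrite divr_gt0 ?exprn_gt0 // mulr_gt0 // ltr0n addn1.
rewrite ltr_pdivrMr ?exprn_gt0 //.
have -> : pi / 2 * 2 ^+ n.+2 = (2 ^ n.+1)%:R * pi :> R.
  by rewrite natrX [2 ^+ n.+2]exprS; field.
by rewrite ltr_pM2r // ltr_nat expnS; lia.
Qed.

Lemma dyadic_angle_double n k : dyadic_angle n k = dyadic_angle n.+1 k *+ 2.
Proof.
rewrite /dyadic_angle [2 ^+ n.+3]exprS.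
by field; rewrite expf_neq0 ?pnatr_eq0.
Qed.

Lemma dyadic_angle_reflect n k : (k < 2 ^ n)%N ->
  dyadic_angle n (2 ^ n - k.+1) = pi / 2 - dyadic_angle n k.
Proof.
move=> k_lt; rewrite /dyadic_angle.
have -> : (2 * (2 ^ n - k.+1) + 1 = 2 ^ n.+1 - (2 * k + 1))%N by rewrite expnS; lia.
rewrite natrB; last by rewrite expnS; lia.
rewrite natrX [2 ^+ n.+2]exprS.
by field; rewrite expf_neq0 ?pnatr_eq0.
Qed.

(* The reflection pairs the angles at level [n + 1] as [y] and [pi / 2 - y],
   and such a pair contributes four times the term of [2 y]. *)
Lemma sum_csc_sqr_dyadic n :
  \sum_(k < 2 ^ n) (sin (dyadic_angle n k)) ^- 2 = 2 * 4 ^+ n.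
Proof.
elim: n => [|n IHn].
  have angleE : dyadic_angle 0 0 = pi / 4 by rewrite /dyadic_angle; field.
  by rewrite big_ord1 angleE sin_pi4_sqr invrK expr0 mulr1.
rewrite exprS mulrCA -IHn mulr_sumr expnS mul2n -addnn big_split_ord /=.
rewrite [X in _ + X](reindex_inj rev_ord_inj) /= -big_split /=.
apply: eq_bigr => i _; have i_lt := ltn_ord i.
have i_lt' : (i < 2 ^ n.+1)%N by rewrite expnS; lia.
have -> : (2 ^ n + (2 ^ n - i.+1) = 2 ^ n.+1 - i.+1)%N by rewrite expnS; lia.
rewrite dyadic_angle_reflect // [dyadic_angle n i]dyadic_angle_double.
have y_itv := dyadic_angle_itv i_lt'; set y := dyadic_angle n.+1 i in y_itv *.
have -> : sin (pi / 2 - y) = cos y.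
  by rewrite sinB sin_pihalf cos_pihalf mul1r mul0r subr0.
apply: csc_sqr_double; rewrite gt_eqF ?sin_gt0_pihalf ?cos_gt0_pihalf //.
by case/andP: y_itv => y0 ->; rewrite andbT; have := @pi_gt0 R; lra.
Qed.

End TrigonometricBounds.

Section EulerProduct.
Variable R : realType.

(* The term [k = 0] vanishes, since [0 ^-1 = 0]. *)
Definition sum_inv_sqr (A : pred nat) (K : nat) : R :=
  \sum_(0 <= k < K) if A k then k%:R ^- 2 else 0.

Lemma sum_inv_sqr_le A K K' : (K <= K')%N -> sum_inv_sqr A K <= sum_inv_sqr A K'.
Proof.
move=> KK'; rewrite /sum_inv_sqr [leRHS](big_cat_nat (leq0n K) KK') /= lerDl.
by apply: sumr_ge0 => k _; case: ifP => // _; rewrite invr_ge0 exprn_ge0.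
Qed.

Lemma sum_inv_sqr_odd_double K :
  sum_inv_sqr odd (K * 2) = \sum_(k < K) (2 * k + 1)%:R ^- 2.
Proof.
rewrite /sum_inv_sqr big_nat_mul big_mkord; apply: eq_bigr => i _.
have -> : (i.+1 * 2 = (i * 2).+2)%N by lia.
rewrite big_ltn ?big_nat1; last by lia.
by rewrite /= oddM andbF add0r /= mulnC addn1.
Qed.

(* Comparing [sin x <= x] at the angles [(2 k + 1) pi / 2 ^ (K + 2)]. *)
Lemma sum_inv_sqr_odd_le K : sum_inv_sqr odd K <= pi ^+ 2 / 8.
Proof.
have pi_pos := @pi_gt0 R; have K_le : (K <= 2 ^ K * 2)%N.
  by rewrite muln2 -addnn ltnW // ltn_addr // ltn_expl.
apply: le_trans (sum_inv_sqr_le _ K_le) _; rewrite sum_inv_sqr_odd_double.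
set step := pi / 2 ^+ K.+2 : R; have step_gt0 : 0 < step by rewrite divr_gt0 ?exprn_gt0.
have angleE k : (2 * k + 1)%:R ^- 2 = step ^+ 2 * dyadic_angle R K k ^- 2 :> R.
  have -> : dyadic_angle R K k = (2 * k + 1)%:R * step by rewrite /step mulrA.
  rewrite [(_ * step) ^+ 2]exprMn [(_ * step ^+ 2)^-1]invfM mulrCA mulfV ?mulr1 //.
  by rewrite gt_eqF // exprn_gt0.
have -> : pi ^+ 2 / 8 = step ^+ 2 * (2 * 4 ^+ K) :> R.
  have -> : 4 ^+ K = 2 ^+ K * 2 ^+ K :> R by rewrite -exprMn; congr (_ ^+ _); ring.
  by rewrite /step !exprS; field; rewrite expf_neq0 ?pnatr_eq0.
rewrite -sum_csc_sqr_dyadic mulr_sumr; apply: ler_sum => k _; rewrite angleE.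
have /andP[angle_gt0 angle_lt] := dyadic_angle_itv R (ltn_ord k).
have sin_gt0 : 0 < sin (dyadic_angle R K k) by rewrite sin_gt0_pihalf ?angle_gt0.
rewrite ler_pM2l ?exprn_gt0 // lef_pV2 ?posrE ?exprn_gt0 //.
by rewrite ler_pXn2r ?nnegrE ?(ltW angle_gt0) ?(ltW sin_gt0) // sin_le_id // ltW.
Qed.

Lemma sum_inv_sqr_split (A : pred nat) p K : (0 < p)%N ->
  (forall k, A (p * k)%N = A k) ->
  sum_inv_sqr A (K * p) =
  sum_inv_sqr (fun k => A k && ~~ (p %| k)%N) (K * p) + p%:R ^- 2 * sum_inv_sqr A K.
Proof.
move=> p0 Ap; rewrite /sum_inv_sqr !big_nat_mul mulr_sumr -big_split /=.
apply: eq_bigr => i _.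
have ip : (i * p < i.+1 * p)%N by rewrite ltn_mul2r p0 ltnSn.
have Ai : A (i * p)%N = A i by rewrite mulnC Ap.
rewrite !(big_ltn ip) Ai dvdn_mull // andbF add0r addrC.
congr (_ + _); last by case: ifP => _; rewrite ?mulr0 // natrM exprMn invfM mulrC.
apply: eq_big_nat => j /andP[j_gt j_lt].
suff -> : ~~ (p %| j)%N by rewrite andbT.
by apply/negP => /dvdnP[q jE]; move: j_gt j_lt; rewrite jE !ltn_mul2r p0 /=; lia.
Qed.

Lemma sum_inv_sqr_le_pi K : sum_inv_sqr predT K <= pi ^+ 2 / 6.
Proof.
have := sum_inv_sqr_le predT (leq_pmulr K (isT : 0 < 2)%N).
rewrite (@sum_inv_sqr_split _ 2) //; have := sum_inv_sqr_odd_le (K * 2).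
have -> : sum_inv_sqr (fun k => predT k && ~~ (2 %| k)%N) (K * 2) =
    sum_inv_sqr odd (K * 2).
  by apply: eq_bigr => k _; rewrite dvdn2 negbK.
by lra.
Qed.

(* Dividing multiples of [p] by [p] shows that they carry the fraction
   [p ^- 2] of the full sum, that is, of the supremum of the partial sums. *)
Lemma sum_inv_sqr_sieve (A : pred nat) p C : (1 < p)%N ->
  (forall k, A (p * k)%N = A k) -> (forall K, sum_inv_sqr A K <= C) ->
  forall K, sum_inv_sqr (fun k => A k && ~~ (p %| k)%N) K <= C * (1 - p%:R ^- 2).
Proof.
move=> p1 Ap A_le K; have p0 := ltnW p1; set A' := fun k => _.
pose E := range (sum_inv_sqr A).
have E_sup : has_sup E.
  by split; [exists (sum_inv_sqr A 0), 0%N | exists C => _ [k _ <-]].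
have le_supE k : sum_inv_sqr A k <= sup E.
  by apply: ub_le_sup => //; [case: E_sup | exists k].
have supE_le : sup E <= C by apply: ge_sup; [case: E_sup | move=> _ [k _ <-]].
have pp : 0 < p%:R ^+ 2 :> R by rewrite exprn_gt0 // ltr0n.
have : sup E <= p%:R ^+ 2 * (sup E - sum_inv_sqr A' K).
  apply: ge_sup; first by case: E_sup.
  move=> _ [k _ <-]; rewrite -ler_pdivrMl // -/(p%:R ^- 2) lerBrDl.
  apply: le_trans (le_supE ((K + k) * p)%N).
  rewrite sum_inv_sqr_split // -/A' lerD //; first by apply: sum_inv_sqr_le; nia.
  by rewrite ler_pM2l ?invr_gt0 // sum_inv_sqr_le // leq_addl.
rewrite -ler_pdivrMl // lerBrDl -lerBrDr => /le_trans; apply.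
have -> : sup E - p%:R ^- 2 * sup E = sup E * (1 - p%:R ^- 2) by ring.
rewrite ler_wpM2r //.
by rewrite subr_ge0 invf_le1 // exprn_ege1 // ler1n.
Qed.

Lemma sum_inv_sqr_coprime (Q : seq nat) : uniq Q -> all prime Q ->
  forall K, sum_inv_sqr (fun k => all (fun p => ~~ (p %| k)%N) Q) K <=
            pi ^+ 2 / 6 * \prod_(p <- Q) (1 - p%:R ^- 2).
Proof.
elim: Q => [_ _ K|p Q IHQ /= /andP[pQ uQ] /andP[p_pr Q_pr] K].
  by rewrite big_nil mulr1 sum_inv_sqr_le_pi.
rewrite big_cons [(1 - _) * _]mulrC mulrA.
set A := fun k => all (fun q => ~~ (q %| k)%N) Q.
have Ap k : A (p * k)%N = A k.
  apply: eq_in_all => q qQ; have q_pr := allP Q_pr _ qQ.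
  rewrite Euclid_dvdM // dvdn_prime2 //.
  by have [qpE|//] := eqVneq q p; rewrite -qpE qQ in pQ.
apply: le_trans (sum_inv_sqr_sieve (prime_gt1 p_pr) Ap (IHQ uQ Q_pr) K).
by rewrite le_eqVlt; apply/orP; left; apply/eqP/eq_bigr => k _; rewrite andbC.
Qed.

Lemma prod_primes_ge (Q : seq nat) : uniq Q -> all prime Q ->
  6 / pi ^+ 2 <= \prod_(p <- Q) (1 - p%:R ^- 2) :> R.
Proof.
move=> uQ Q_pr; have := sum_inv_sqr_coprime uQ Q_pr 2.
have pi_sqr_gt0 : 0 < pi ^+ 2 :> R by rewrite exprn_gt0 // pi_gt0.
have coprime1 : all (fun p => ~~ (p %| 1)%N) Q.
  by apply/allP => p /(allP Q_pr) p_pr; rewrite dvdn1 gtn_eqF // prime_gt1.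
rewrite /sum_inv_sqr big_ltn // big_nat1 coprime1 expr1n invr1.
by rewrite expr0n invr0 if_same add0r ler_pdivrMr //; lra.
Qed.

End EulerProduct.

(** * Lower densities *)

Lemma count_symE (S : int -> Prop) N :
  count_sym S N = (\sum_(0 <= k < (2 * N).+1) `[< S (k%:Z - N%:Z)%R >])%N.
Proof.
rewrite /count_sym big_mkord -sum1_card big_mkcond /=.
by apply: eq_bigr => k _; rewrite inE; case: asbool.
Qed.

Section LowerDensity.
Variable R : realType.
Implicit Types S : int -> Prop.

Lemma density_lower_bound_linear_error S (B : R) :
  (forall eps : R, 0 < eps -> exists C : R, forall N,
     (B - eps) * (2 * N).+1%:R <= (count_sym S N)%:R + C) ->
  density_lower_bound S B.
Proof.
move=> count_ge eps eps0; have eps2 : 0 < eps / 2 by rewrite divr_gt0.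
have [C {}count_ge] := count_ge _ eps2.
exists (Num.truncn (C / (eps / 2))).+1 => N N_ge; rewrite ler_pdivlMr //.
have : C < (2 * N).+1%:R * (eps / 2).
  rewrite -ltr_pdivrMr //; apply: lt_le_trans (truncnS_gt _) _.
  by rewrite ler_nat ltnS (leq_trans (ltnW N_ge)) ?leq_pmull.
by have := count_ge N; lra.
Qed.

Lemma density_lower_bound_subset S1 S2 (B : R) : (forall d, S1 d -> S2 d) ->
  density_lower_bound S1 B -> density_lower_bound S2 B.
Proof.
move=> S12 dens eps /dens[N0 count_ge]; exists N0 => N /count_ge/le_trans; apply.
rewrite ler_pM2r ?invr_gt0 ?ltr0n // ler_nat; apply/subset_leq_card/fintype.subsetP => k.
by rewrite !finset.in_set => /asboolP Sk; apply/asboolP/S12.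
Qed.

Lemma density_lower_bound_inter S1 S2 (B1 B2 : R) :
  density_lower_bound S1 B1 -> density_lower_bound S2 B2 ->
  density_lower_bound (fun d => S1 d /\ S2 d) (B1 - (1 - B2)).
Proof.
move=> dens1 dens2 eps eps0; have eps2 : 0 < eps / 2 by rewrite divr_gt0.
have [N1 count1] := dens1 _ eps2; have [N2 count2] := dens2 _ eps2.
exists (maxn N1 N2) => N; rewrite geq_max => /andP[/count1 {}count1 /count2 {}count2].
move: count1 count2; rewrite !ler_pdivlMr //.
have : (count_sym S1 N + count_sym S2 N <=
        count_sym (fun d => S1 d /\ S2 d) N + (2 * N).+1)%N.
  rewrite /count_sym -cardsUI addnC leq_add //.
    apply/subset_leq_card/fintype.subsetP => k.
    rewrite finset.in_setI !finset.in_set => /andP[/asboolP S1k /asboolP S2k].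
    exact/asboolP.
  by rewrite -[leqRHS]card_ord max_card.
by rewrite -(ler_nat R) !natrD; lra.
Qed.

Lemma count_sym_bounded S M N :
  (forall d, S d -> (`|d| <= M)%N) -> (count_sym S N <= (2 * M).+1)%N.
Proof.
move=> S_le; rewrite -[leqRHS]card_ord /count_sym.
set A := [set k : 'I__ | _].
pose f (k : 'I_(2 * N).+1) : 'I_(2 * M).+1 := inord (k + M - N).
have A_itv k : k \in A -> (N <= k + M <= N + 2 * M)%N.
  by rewrite finset.in_set => /asboolP/S_le; lia.
rewrite -(@card_in_imset _ _ f) ?max_card // => k l /A_itv kA /A_itv lA /(congr1 val).
by rewrite /= !inordK ?ltnS; [move=> kl; apply: val_inj => /=; lia | lia | lia].
Qed.

Lemma density_lower_bound_unbounded S (B : R) : 0 < B -> density_lower_bound S B ->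
  forall M, exists d, (M < `|d|)%N /\ S d.
Proof.
move=> B0 S_dens M; apply: contrapT => S_bounded.
have {}S_bounded d : S d -> (`|d| <= M)%N.
  by move=> Sd; rewrite leqNgt; apply/negP => Md; apply: S_bounded; exists d.
have B2 : 0 < B / 2 by rewrite divr_gt0.
have [N0 /= count_ge] := S_dens _ B2.
pose N := maxn N0 (Num.truncn ((2 * M).+1%:R / (B / 2))).
have := count_ge N (leq_maxl _ _); rewrite ler_pdivlMr //.
have := count_sym_bounded N S_bounded; rewrite -(ler_nat R).
have : (2 * M).+1%:R < (2 * N).+1%:R * (B / 2).
  rewrite -ltr_pdivrMr // (lt_le_trans (truncnS_gt _)) // ler_nat ltnS.
  by rewrite (leq_trans (leq_maxr N0 _)) // leq_pmull.
by lra.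
Qed.

End LowerDensity.

(** * Sieving affine forms *)

Definition affine (a b x : int) : int := a * x + b.

Definition avoids (Q : seq nat) (v : int) : bool :=
  all (fun q : nat => ~~ (q %| v)%Z) Q.

Section AffineCounting.
Local Open Scope nat_scope.

Lemma dvdz_affine (a b : int) q : 0 < q -> coprimez q a ->
  exists2 r, r < q & forall k : nat, (q %| affine a b k)%Z = (k %% q == r).
Proof.
move=> q0 qa; have /coprimezP[[u v] /= uv] := qa.
have qZ0 : q%:Z != 0%R by rewrite -lt0n.
pose r := (- b * v %% q)%Z; have r0 : (0 <= r)%R by exact: modz_ge0.
exists `|r|; first by rewrite -ltz_nat gez0_abs ?ltz_mod.
move=> k; rewrite -eqz_nat -modz_nat gez0_abs // eqz_mod_dvd.
have -> : (k%:Z - - b * v = v * affine a b k + q%:Z * (u * k%:Z))%R.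
  by rewrite /affine -[in LHS](mulr1 k%:Z) -uv; ring.
rewrite [RHS]rpredDr; last exact: dvdz_mulr.
rewrite Gauss_dvdzr //.
by apply/coprimezP; exists (u, a); rewrite /= -uv; ring.
Qed.

Lemma sum_nat_blocks (F : nat -> nat) T q :
  \sum_(0 <= k < T * q) F k = \sum_(0 <= r < q) \sum_(0 <= i < T) F (r + i * q).
Proof.
rewrite exchange_big big_nat_mul /=; apply: eq_bigr => i _.
by rewrite -{1}[i * q]add0n big_addn mulSn addnK.
Qed.

Lemma sum_dvd_affine (a b : int) q T : 0 < q -> coprimez q a ->
  \sum_(0 <= k < T * q) (q %| affine a b k)%Z = T.
Proof.
move=> q0 /(dvdz_affine b q0)[r rq rP].
have dvd_block s i : s < q -> (q %| affine a b (s + i * q)%N)%Z = (s == r).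
  by move=> sq; rewrite rP addnC modnMDl modn_small.
rewrite sum_nat_blocks big_nat (eq_bigr (fun s => T * (s == r))); last first.
  move=> s /= sq; rewrite (eq_bigr (fun=> nat_of_bool (s == r))) => [|i _].
    by rewrite sum_nat_const_nat subn0.
  by rewrite dvd_block.
rewrite -big_nat big_mkord (bigD1 (Ordinal rq)) //= eqxx muln1 big1 ?addn0 // => s.
by rewrite -val_eqE /= => /negPf ->; rewrite muln0.
Qed.

Lemma sum_dvd_affine_le (a b : int) q L : 0 < q -> coprimez q a ->
  \sum_(0 <= k < L) (q %| affine a b k)%Z <= L %/ q + 1.
Proof.
move=> q0 qa; rewrite -[leqRHS](sum_dvd_affine b _ q0 qa).
have Lq : L <= (L %/ q + 1) * q by rewrite addn1 ltnW // ltn_ceil.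
by rewrite [leqRHS](big_cat_nat (leq0n _) Lq) /= leq_addr.
Qed.

Lemma sum_affine_eq0_le1 (a b : int) L : a != 0%R ->
  \sum_(0 <= k < L) (affine a b k == 0%R) <= 1.
Proof.
move=> a0; rewrite big_mkord.
have [k0 /eqP k0_root|no_root] := pickP (fun k : 'I_L => affine a b k == 0%R); last first.
  by rewrite big1 // => k _; rewrite no_root.
rewrite (bigD1 k0) //= k0_root eqxx big1 // => k; apply: contraNeq.
rewrite eqb0 negbK => /eqP k_root; rewrite -val_eqE /= -eqz_nat.
by apply/eqP/(mulfI a0)/(addIr b); rewrite -/(affine a b _) k_root.
Qed.

Lemma sum_avoids_period (Q : seq nat) (a b : int) T :
  all (fun q => (0 < q) && coprimez q a) Q -> pairwise coprime Q ->
  \sum_(0 <= k < T * \prod_(q <- Q) q) avoids Q (affine a b k) =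
  T * \prod_(q <- Q) q.-1.
Proof.
elim: Q a b T => [|q Q IHQ] a b T /=.
  by rewrite !big_nil !muln1 sum_nat_const_nat subn0 muln1.
move=> /andP[/andP[q0 qa] Qa] /andP[qQ Q_coprime].
have Qaq : all (fun q' => (0 < q') && coprimez q' (a * q%:Z)%R) Q.
  apply/allP => q' q'Q; have /andP[-> q'a] := allP Qa _ q'Q.
  by rewrite coprimezMr q'a coprimezE /= coprime_sym (allP qQ).
rewrite !big_cons [q * _]mulnC mulnA sum_nat_blocks.
have sum_class r : \sum_(0 <= i < T * \prod_(j <- Q) j)
    avoids (q :: Q) (affine a b (r + i * q)%N) =
    ~~ (q %| affine a b r)%Z * (T * \prod_(j <- Q) j.-1).
  rewrite -(IHQ _ (affine a b r) T Qaq Q_coprime) big_distrr; apply: eq_bigr => i _ /=.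
  have -> : affine a b (r + i * q)%N = affine (a * q%:Z) (affine a b r) i.
    by rewrite /affine PoszD PoszM; ring.
  rewrite /affine rpredDl; last by rewrite -mulrA dvdz_mull // dvdz_mulr.
  by case: (_ \in _); rewrite ?mul1n.
rewrite (eq_bigr _ (fun r _ => sum_class r)) -big_distrl /= mulnCA; congr (_ * (_ * _)).
have := sum_dvd_affine b 1 q0 qa; rewrite mul1n => sum_dvd.
have : \sum_(0 <= r < q) ((q %| affine a b r)%Z + ~~ (q %| affine a b r)%Z) = q.
  rewrite (eq_bigr (fun=> 1)) ?sum_nat_const_nat ?subn0 ?muln1 //.
  by move=> r _; case: (_ \in _).
by rewrite big_split /= sum_dvd => /(congr1 predn).
Qed.

Lemma sum_avoids_ge (R : realType) (Q : seq nat) (a b : int) L :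
  all (fun q => (0 < q) && coprimez q a) Q -> pairwise coprime Q ->
  (L%:R * \prod_(q <- Q) (1 - q%:R^-1) - (\prod_(q <- Q) q)%:R <=
   (\sum_(0 <= k < L) avoids Q (affine a b k))%:R :> R)%R.
Proof.
move=> Qa Q_coprime; set M := \prod_(q <- Q) q; set P := (\prod_(q <- Q) _)%R.
have Q_gt0 q : q \in Q -> 0 < q by move=> /(allP Qa)/andP[].
have M0 : 0 < M by rewrite /M big_seq prodn_cond_gt0.
have ML : L %/ M * M <= L by exact: leq_trunc_div.
have PE : ((\prod_(q <- Q) q.-1)%:R = M%:R * P :> R)%R.
  rewrite /M /P !natr_prod -big_split big_seq [RHS]big_seq.
  apply: eq_bigr => q /Q_gt0 q0 /=.
  by rewrite -subn1 natrB // mulrBr mulr1 divff // pnatr_eq0 -lt0n.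
have P_le1 : (0 <= P <= 1)%R.
  have q_itv q : q \in Q -> (0 <= 1 - q%:R^-1 :> R)%R && (1 - q%:R^-1 <= 1 :> R)%R.
    move=> /Q_gt0 q0; rewrite gerBl invr_ge0 ler0n andbT.
    by rewrite subr_ge0 invf_le1 ?ltr0n ?ler1n.
  rewrite /P big_seq prodr_ile1 ?andbT => [|q /q_itv //].
  by apply: prodr_ge0 => q /q_itv/andP[].
apply: (@le_trans _ _ ((L %/ M * \prod_(q <- Q) q.-1)%:R)%R); last first.
  rewrite -(sum_avoids_period b _ Qa Q_coprime) ler_nat.
  by rewrite [leqRHS](big_cat_nat (leq0n _) ML) leq_addr.
have L_le : (L%:R - M%:R <= (L %/ M)%:R * M%:R :> R)%R.
  by rewrite lerBlDr -natrM -natrD ler_nat -mulSnr ltnW // ltn_ceil.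
rewrite natrM PE mulrA; case/andP: P_le1 => P0 P1; have := ler_wpM2r P0 L_le.
by apply: le_trans; rewrite mulrBl lerB // ler_piMr.
Qed.

End AffineCounting.

Definition powerfree (sel : pred nat) (e : nat -> nat) (v : int) : Prop :=
  forall p, prime p -> sel p -> ~~ ((p ^ e p)%N %| v)%Z.

Definition primes_below (sel : pred nat) (y : nat) : seq nat :=
  [seq p <- index_iota 0 y | prime p && sel p].

Lemma primes_below_uniq sel y : uniq (primes_below sel y).
Proof. by rewrite filter_uniq // iota_uniq. Qed.

Lemma mem_primes_below sel y p :
  (p \in primes_below sel y) = [&& prime p, sel p & (p < y)%N].
Proof. by rewrite mem_filter mem_index_iota /= andbA. Qed.

Lemma sum_inv_sqr_tail (R : realType) (K Z : nat) : (0 < K)%N ->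
  \sum_(K.+1 <= p < Z) p%:R ^- 2 <= K%:R^-1 :> R.
Proof.
move=> K0; rewrite big_add1; have [ZK|KZ] := leqP Z.-1 K.
  by rewrite big_geq // invr_ge0.
apply: (@le_trans _ _ (\sum_(K <= k < Z.-1) (- k.+1%:R^-1 - - k%:R^-1))).
  rewrite big_nat [leRHS]big_nat; apply: ler_sum => k /andP[Kk _].
  have k0 : 0 < k%:R :> R by rewrite ltr0n (leq_trans K0).
  rewrite -natr1; have -> : - (k%:R + 1)^-1 - - k%:R^-1 = (k%:R * (k%:R + 1))^-1 :> R.
    by field; rewrite !gt_eqF //; lra.
  by rewrite lef_pV2 ?posrE ?mulr_gt0 ?exprn_gt0 //; nra.
by rewrite telescope_sumr ?(ltnW KZ) // opprK addrC gerBl invr_ge0.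
Qed.

Lemma sum_div_sqr_le (R : realType) (L K X : nat) : (0 < K)%N ->
  (\sum_(K.+1 <= p < X.+1) (L %/ p ^ 2 + 1))%:R <= L%:R / K%:R + X%:R :> R.
Proof.
move=> K0; rewrite natr_sum.
apply: (@le_trans _ _ (\sum_(K.+1 <= p < X.+1) (L%:R * p%:R ^- 2 + 1))).
  rewrite big_nat [leRHS]big_nat; apply: ler_sum => p /andP[Kp _].
  rewrite natrD lerD2r ler_pdivlMr -?natrX ?ltr0n ?expn_gt0 ?(leq_trans _ Kp) //.
  by rewrite -natrM ler_nat leq_trunc_div.
rewrite big_split -mulr_sumr lerD ?ler_wpM2l ?sum_inv_sqr_tail //.
by rewrite sumr_const_nat ler_nat; lia.
Qed.

Lemma ltn_sqr_div_add (s K L : nat) : (0 < K)%N ->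
  (s * L < (L %/ K + K * s).+1 ^ 2)%N.
Proof.
move=> K0; set X := (L %/ K + K * s)%N.
have LX : (L <= K * X.+1)%N.
  rewrite ltnW // (leq_trans (ltn_ceil L K0)) // mulnC leq_mul2l ltnS leq_addr.
  by rewrite orbT.
have KsX : (K * s <= X)%N by rewrite leq_addl.
by nia.
Qed.

Section PowerfreeDensity.
Variables (a b : int) (sel : pred nat) (e : nat -> nat) (y0 : nat).
Hypothesis a0 : a != 0.
Hypothesis sel_coprime : forall p, prime p -> sel p -> coprime p `|a|.
Hypothesis e_gt0 : forall p, (0 < e p)%N.
Hypothesis e_ge2 : forall p, (y0 <= p)%N -> (1 < e p)%N.

Let moduli y := [seq (p ^ e p)%N | p <- primes_below sel y].

Lemma moduli_coprimez y : all (fun q => (0 < q)%N && coprimez q a) (moduli y).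
Proof.
apply/allP => _ /mapP[p + ->]; rewrite mem_primes_below => /and3P[p_pr p_sel _].
by rewrite expn_gt0 prime_gt0 //= coprimezE /= coprime_pexpl // sel_coprime.
Qed.

Lemma moduli_pairwise_coprime y : pairwise coprime (moduli y).
Proof.
have : pairwise (fun p q => p != q) (primes_below sel y).
  by rewrite -uniq_pairwise primes_below_uniq.
rewrite pairwise_map; apply: (sub_in_pairwise (P := mem (primes_below sel y))).
  move=> p q; rewrite /= !mem_primes_below => /and3P[p_pr _ _] /and3P[q_pr _ _] pq.
  by rewrite coprime_pexpl // coprime_pexpr // prime_coprime // dvdn_prime2.
exact/allP.
Qed.

(* A nonzero value avoiding the small moduli and divisible by [p ^ e p] for a
   large [p] is divisible by [p ^ 2], so its size bounds [p]. *)
Lemma avoids_le_powerfree (v : int) y X : (y0 <= y)%N -> (`|v| < X.+1 ^ 2)%N ->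
  (avoids (moduli y) v <= `[< powerfree sel e v >] +
     \sum_(y <= p < X.+1 | prime p && sel p) ((p ^ 2)%N %| v)%Z + (v == 0))%N.
Proof.
move=> y0y v_lt; case: (boolP (avoids _ _)) => // /allP v_avoids.
have [v_free|] := pselect (powerfree sel e v).
  by rewrite asboolT // -addnA leq_addr.
have [v0 _|v0] := eqVneq v 0; first by rewrite addn1.
move=> /existsNP[p /not_implyP[p_pr /not_implyP[p_sel /negP/negPn pev]]].
have yp : (y <= p)%N.
  rewrite leqNgt; apply: contraL pev => py; apply: v_avoids.
  by apply/mapP; exists p; rewrite // mem_primes_below p_pr p_sel.
have p2v : ((p ^ 2)%N %| v)%Z.
  by apply: dvdz_trans pev; rewrite dvdzE /= dvdn_exp2l // e_ge2 // (leq_trans y0y).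
have pX : (p < X.+1)%N.
  rewrite -ltn_sqr; apply: leq_ltn_trans v_lt.
  by rewrite dvdn_leq // absz_gt0.
rewrite addn0 (leq_trans _ (leq_addl _ _)) // big_mkcond.
by rewrite (bigD1_seq p) ?mem_index_iota ?yp ?pX ?iota_uniq //= p_pr p_sel p2v.
Qed.

Lemma sum_avoids_le_powerfree b' y X L : (y0 <= y)%N ->
  (forall k : nat, (k < L)%N -> (`|affine a b' k| < X.+1 ^ 2)%N) ->
  (\sum_(0 <= k < L) avoids (moduli y) (affine a b' k) <=
   \sum_(0 <= k < L) `[< powerfree sel e (affine a b' k) >] +
   \sum_(y <= p < X.+1) (L %/ p ^ 2 + 1) + 1)%N.
Proof.
move=> y0y v_lt; pose F (k : nat) := (`[< powerfree sel e (affine a b' k) >] +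
  \sum_(y <= p < X.+1 | prime p && sel p) ((p ^ 2)%N %| affine a b' k)%Z +
  (affine a b' k == 0))%N.
apply: (@leq_trans (\sum_(0 <= k < L) F k)).
  rewrite big_nat [leqRHS]big_nat; apply: leq_sum => k /andP[_ kL].
  exact: avoids_le_powerfree (v_lt k kL).
rewrite /F big_split /= leq_add ?sum_affine_eq0_le1 // big_split /= leq_add2l.
rewrite exchange_big /= [leqLHS]big_mkcond; apply: leq_sum => p _.
case: ifP => // /andP[p_pr p_sel]; apply: sum_dvd_affine_le.
  by rewrite expn_gt0 prime_gt0.
by rewrite coprimezE /= coprime_pexpl // sel_coprime.
Qed.

Lemma count_powerfree_affine_ge (R : realType) K N : (y0 <= K)%N -> (0 < K)%N ->
  (2 * N).+1%:R * \prod_(p <- primes_below sel K.+1) (1 - (p ^ e p)%N%:R^-1)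
    - (2 * N).+1%:R * (2 / K%:R)
    - (\prod_(q <- moduli K.+1) q + K * (`|a| + `|b|) + 1)%N%:R <=
  (count_sym (fun d => powerfree sel e (affine a b d)) N)%:R :> R.
Proof.
move=> y0K K0; set L := (2 * N).+1; set s := (`|a| + `|b|)%N.
pose X := (L %/ K + K * s)%N; pose b' := b - a * N%:Z.
have shiftE (k : nat) : affine a b' k = affine a b (k%:Z - N%:Z).
  by rewrite /affine /b'; ring.
have v_lt (k : nat) : (k < L)%N -> (`|affine a b' k| < X.+1 ^ 2)%N.
  move=> kL; apply: leq_ltn_trans (ltn_sqr_div_add s L K0).
  have kN : (`|k%:Z - N%:Z| <= L)%N by rewrite /L in kL *; lia.
  rewrite shiftE; apply: (@leq_trans (`|(a * (k%:Z - N%:Z))%R| + `|b|)).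
    by rewrite /affine; lia.
  by rewrite abszM mulnDl leq_add ?leq_pmulr // leq_mul2l kN orbT.
have := sum_avoids_ge R b' L (moduli_coprimez K.+1) (moduli_pairwise_coprime K.+1).
have := sum_avoids_le_powerfree (leq_trans y0K (leqnSn K)) v_lt.
have -> : count_sym (fun d => powerfree sel e (affine a b d)) N =
    (\sum_(0 <= k < L) `[< powerfree sel e (affine a b' k) >])%N.
  by rewrite count_symE; apply: eq_bigr => k _; rewrite shiftE.
have div_le : (L %/ K)%:R <= L%:R / K%:R :> R.
  by rewrite ler_pdivlMr ?ltr0n // -natrM ler_nat leq_trunc_div.
have := sum_div_sqr_le R L X K0; rewrite big_map -(ler_nat R) !natrD.
by lra.
Qed.

Lemma density_powerfree_affine (R : realType) (B : R) :
  (forall y, (y0 <= y)%N ->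
     B <= \prod_(p <- primes_below sel y) (1 - (p ^ e p)%N%:R^-1)) ->
  density_lower_bound (fun d => powerfree sel e (affine a b d)) B.
Proof.
move=> B_le; apply: density_lower_bound_linear_error => eps eps0.
have [K [y0K K0 K_large]] : exists K, [/\ (y0 <= K)%N, (0 < K)%N & 2 / K%:R <= eps].
  exists (y0 + Num.truncn (2 / eps)).+1; split=> //; first exact: leqW (leq_addr _ _).
  rewrite ler_pdivrMr // mulrC -ler_pdivrMr // ltW // (lt_le_trans (truncnS_gt _)) //.
  by rewrite ler_nat ltnS leq_addl.
eexists => N; have := count_powerfree_affine_ge R N y0K K0; rewrite lerBlDr.
apply: le_trans; have L0 : 0 <= (2 * N).+1%:R :> R by [].
by rewrite mulrC mulrBr lerB ?ler_wpM2l // B_le // leqW.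
Qed.

End PowerfreeDensity.

(** * Densities of the two conditions *)

Section Bound.
Variable R : realType.

Lemma prod_prime_divisors (m y : nat) (G : nat -> R) : (0 < m)%N -> (m < y)%N ->
  \prod_(p <- primes_below predT y) (if (p %| m)%N then G p else 1) =
  \prod_(p <- primes m) G p.
Proof.
move=> m0 my; rewrite -big_mkcond -big_filter; apply: perm_big.
apply: uniq_perm; [exact/filter_uniq/primes_below_uniq | exact: primes_uniq | move=> p].
rewrite mem_filter mem_primes_below mem_primes m0 /=.
have [pm|] := boolP (p %| m)%N; rewrite ?andbF //= andbT.
by rewrite (leq_ltn_trans (dvdn_leq m0 pm) my) andbT.
Qed.

Lemma prod_primes_below_ge (m y : nat) (F G : nat -> R) : (0 < m)%N -> (m < y)%N ->
  (forall p, prime p -> 0 <= G p) ->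
  (forall p, prime p -> F p = (1 - p%:R ^- 2) * (if (p %| m)%N then G p else 1)) ->
  6 / pi ^+ 2 * \prod_(p <- primes m) G p <= \prod_(p <- primes_below predT y) F p.
Proof.
move=> m0 my G0 FE; rewrite -(prod_prime_divisors G m0 my).
have below_prime p : p \in primes_below predT y -> prime p.
  by rewrite mem_primes_below => /andP[].
rewrite [leRHS]big_seq (eq_bigr _ (fun p h => FE p (below_prime p h))) -big_seq.
rewrite big_split ler_wpM2r //.
  rewrite big_seq; apply: prodr_ge0 => p /below_prime p_pr.
  by case: ifP => // _; exact: G0.
by apply: prod_primes_ge; [exact: primes_below_uniq | exact/allP].
Qed.

Lemma powerfree_squarefree_coprime (c d : int) : c != 0 ->
  powerfree predT (fun p => if (p %| `|c|)%N then 1 else 2) (affine 1 0 d) ->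
  squarefree d /\ coprimez c d.
Proof.
rewrite /affine mul1r addr0 => c0 d_free; split.
  apply/squarefreeP => p p_pr; have := d_free p p_pr isT.
  by case: ifP => // _; apply: contra; apply: dvdz_trans; rewrite dvdzE dvdn_exp2l.
rewrite coprimezE /coprime eqn_leq gcdn_gt0 absz_gt0 c0 andbT leqNgt.
apply/negP => gcd_gt1; have := pdiv_dvd (gcdn `|c| `|d|); rewrite dvdn_gcd.
move=> /andP[pc pd]; have := d_free _ (pdiv_prime gcd_gt1) isT.
by rewrite pc expn1 dvdzE /= pd.
Qed.

Lemma density_squarefree_coprime (c : int) : c != 0 ->
  density_lower_bound (fun d => squarefree d /\ coprimez c d)
    (6 / pi ^+ 2 * \prod_(p <- primes `|c|) (p%:R / (p%:R + 1)) : R).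
Proof.
move=> c0; have c_gt0 : (0 < `|c|)%N by rewrite absz_gt0.
apply: density_lower_bound_subset => [d|]; first exact: powerfree_squarefree_coprime.
apply: (@density_powerfree_affine _ _ _ _ `|c|.+1) => // [p _ _|p|p cp|y cy].
- by rewrite coprimen1.
- by case: ifP.
- by case: ifP => // /(dvdn_leq c_gt0); rewrite leqNgt cp.
apply: prod_primes_below_ge => // p p_pr; first by rewrite divr_ge0 ?addr_ge0.
have p0 : 0 < p%:R :> R by rewrite ltr0n prime_gt0.
case: ifP => _; last by rewrite natrX mulr1.
by rewrite expn1; field; rewrite !gt_eqF ?addr_gt0.
Qed.

Lemma density_reduced_disc (n : nat) (c : int) : (0 < n)%N ->
  density_lower_bound
    (fun d => forall p, prime p -> ~~ (p %| n)%N ->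
       ~~ ((p ^ 2)%N %| reduced_disc n c d)%Z)
    (6 / pi ^+ 2 * \prod_(p <- primes n) (p%:R ^+ 2 / (p%:R ^+ 2 - 1)) : R).
Proof.
move=> n0; pose sel p := ~~ (p %| n)%N.
apply: (@density_powerfree_affine (n%:R ^+ n) _ sel (fun=> 2) n.+1) => //
  [|p p_pr pn|y ny].
- by rewrite expf_neq0 // natz -lt0n.
- by rewrite natz abszX /= coprimeXr // prime_coprime.
have -> : \prod_(p <- primes_below sel y) (1 - (p ^ 2)%N%:R^-1) =
    \prod_(p <- primes_below predT y) (if sel p then 1 - (p ^ 2)%N%:R^-1 else 1) :> R.
  rewrite -big_mkcond -[RHS]big_filter -filter_predI; congr (\prod_(p <- _) _).
  by apply: eq_filter => p /=; rewrite andbT andbC.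
apply: prod_primes_below_ge => // p p_pr;
  have p1 : 1 < p%:R :> R by rewrite ltr1n prime_gt1.
  by rewrite divr_ge0 ?exprn_ge0 // subr_ge0 exprn_ege1 // ltW.
rewrite /sel natrX; case: (p %| n)%N => /=; last by rewrite mulr1.
by field; rewrite !gt_eqF ?subr_gt0 ?exprn_egt1 // (lt_trans _ p1).
Qed.

Lemma ratio_succ_le (k m : nat) : (k <= m)%N ->
  k%:R / (k%:R + 1) <= m%:R / (m%:R + 1) :> R.
Proof.
move=> km; rewrite !natr1 ler_pdivrMr // mulrAC ler_pdivlMr //.
by rewrite -!natrM ler_nat; lia.
Qed.

Lemma prod_prime_ratio_ge (m : nat) :
  (size (primes m) == 1)%N \/ ((size (primes m) == 2)%N && coprime m 6) ->
  2 / 3 <= \prod_(p <- primes m) (p%:R / (p%:R + 1)) :> R.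
Proof.
case=> [/eqP|/andP[/eqP + m6]].
  case m_primes: (primes m) => [|p [|? ?]] // _; rewrite big_seq1.
  have /andP[/prime_gt1/(@ratio_succ_le 2) + _] : prime p && ((0 < m)%N && (p %| m)%N).
    by rewrite -mem_primes m_primes mem_head.
  by apply: le_trans; rewrite natr1.
have ratio_ge p : p \in primes m -> 5 / 6 <= p%:R / (p%:R + 1) :> R.
  rewrite mem_primes => /and3P[p_pr _ /coprime_dvdl/(_ m6) p6].
  have /(@ratio_succ_le 5) : (5 <= p)%N by case: p p_pr p6 => [|[|[|[|[]]]]].
  by apply: le_trans; rewrite natr1.
case m_primes: (primes m) ratio_ge => [|p [|q [|? ?]]] // ratio_ge _; rewrite big_cons big_seq1.
have := ratio_ge p (mem_head _ _); have : 5 / 6 <= q%:R / (q%:R + 1) :> R.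
  by apply: ratio_ge; rewrite !inE eqxx orbT.
by nra.
Qed.

Lemma prod_prime_sqr_ratio_ge1 (m : nat) :
  1 <= \prod_(p <- primes m) (p%:R ^+ 2 / (p%:R ^+ 2 - 1)) :> R.
Proof.
rewrite big_seq; elim/big_ind: _ => // [u v|p]; first exact: mulr_ege1.
rewrite mem_primes => /andP[/prime_gt1 p1 _].
have p2 : 1 < p%:R ^+ 2 :> R by rewrite exprn_egt1 // ltr1n.
by rewrite ler_pdivlMr ?subr_gt0 //; lra.
Qed.

Lemma Bconst_gt0 (n : nat) (c : int) :
  (size (primes `|c|) == 1)%N \/ ((size (primes `|c|) == 2)%N && coprime `|c| 6) ->
  0 < Bconst R n c.
Proof.
move=> /prod_prime_ratio_ge; have := prod_prime_sqr_ratio_ge1 n; rewrite /Bconst.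
have : 3 / 5 < 6 / pi ^+ 2 :> R.
  by rewrite ltr_pdivlMr ?exprn_gt0 ?pi_gt0 //; have := @pi_sqr_lt10 R; lra.
move: (6 / _) (\prod_(p <- primes n) _) (\prod_(p <- primes `|c|) _) => z v u.
by nra.
Qed.

End Bound.

Theorem theorem3p6 (R : realType) (n : nat) (c : int) :
  (2 < n)%N -> c != 0 -> squarefree c -> c != 1 -> c != -1 ->
  density_lower_bound (good_d n c) (Bconst R n c) /\
  ((size (primes `|c|) == 1)%N \/
   ((size (primes `|c|) == 2)%N && coprime `|c| 6) ->
     0 < Bconst R n c /\ forall M : nat, exists d : int, (M < `|d|)%N /\ good_d n c d).
Proof.
move=> n2 c0 c_sqf c1 cN1; have n1 := ltnW n2.
have dens : density_lower_bound (good_d n c) (Bconst R n c).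
  have dens_d := @density_squarefree_coprime R c c0.
  have dens_disc := @density_reduced_disc R n c (ltnW n1).
  apply: density_lower_bound_subset (density_lower_bound_inter dens_d dens_disc) => d.
  by move=> [[d_sqf cd] p2disc]; exact: good_d_criterion.
split=> // /(@Bconst_gt0 R n c) B0; split=> //.
exact: density_lower_bound_unbounded B0 dens.
Qed.
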